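(* (a) If $\mathcal{C}$ is an $(\alpha+\gamma\beta)$-constacyclic code of length $np^s$ over $\mathcal{R}_2$ (i.e., an ideal of the ring $\mathcal{R}_{\alpha,\beta}$), then, under the identification $\mathcal{R}_{\alpha,\beta}\simeq\bigoplus_{j=1}^r\mathcal{K}_j$, we have $\mathcal{C}=\mathcal{C}_1\oplus\mathcal{C}_2\oplus\cdots\oplus\mathcal{C}_r$, where $\mathcal{C}_j$ is an ideal of $\mathcal{K}_j$ for $1\le j\le r$. (b) Let $I_j$ be an ideal of $\mathcal{K}_j$ for $1\le j\le r$. Then $I=I_1\oplus I_2\oplus\cdots\oplus I_r$ is an ideal of $\mathcal{R}_{\alpha,\beta}$ (i.e., $I$ is an $(\alpha+\gamma\beta)$-constacyclic code of length $np^s$ over $\mathcal{R}_2$). Furthermore, $|I|=|I_1||I_2|\cdots|I_r|$.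
   Context: $\mathcal{R}_2$ is a finite commutative chain ring with unity, with maximal ideal $\langle\gamma\rangle$, where $\gamma\neq0$ and $\gamma^2=0$; its residue field $\overline{\mathcal{R}_2}=\mathcal{R}_2/\langle\gamma\rangle$ has order $p^m$, $p$ prime. $\zeta\in\mathcal{R}_2$ is an element of multiplicative order $p^m-1$ and $\mathcal{T}_2=\{0,1,\zeta,\dots,\zeta^{p^m-2}\}$ is the Teichmüller set. $n,s$ are positive integers with $\gcd(n,p)=1$. $\alpha\in\mathcal{T}_2\setminus\{0\}$, $\beta\in\mathcal{T}_2$, $\lambda=\alpha+\gamma\beta$ (every unit of $\mathcal{R}_2$ has this form), and $\alpha_0\in\mathcal{T}_2$ satisfies $\alpha_0^{p^s}=\alpha$. A $\lambda$-constacyclic code of length $N$ over $\mathcal{R}_2$ is an $\mathcal{R}_2$-submodule of $\mathcal{R}_2^N$ closed under $(a_0,\dots,a_{N-1})\mapsto(\lambda a_{N-1},a_0,\dots,a_{N-2})$; via $(a_0,\dots,a_{N-1})\mapsto\sum a_ix^i$ such codes are identified with ideals of $\mathcal{R}_2[x]/\langle x^N-\lambda\rangle$. Put $\mathcal{R}_{\alpha,\beta}=\mathcal{R}_2[x]/\langle x^{np^s}-\alpha-\gamma\beta\rangle$. Write $x^n-\alpha_0=f_1(x)\cdots f_r(x)$ with $f_j$ monic, pairwise coprime and basic irreducible (irreducible modulo $\gamma$) in $\mathcal{R}_2[x]$, $d_j=\deg f_j$. Then $x^{np^s}-\lambda=\prod_{j=1}^r k_j(x)$ with $k_j(x)=f_j(x)^{p^s}+\gamma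 g_j(x)$ monic, pairwise coprime, of degree $d_jp^s$, for certain $g_j\in\mathcal{R}_2[x]$ (the $k_j$ are uniquely determined by these properties). Put $\mathcal{K}_j=\mathcal{R}_2[x]/\langle k_j(x)\rangle$. The Chinese Remainder Theorem gives the ring isomorphism $\mathcal{R}_{\alpha,\beta}\simeq\bigoplus_{j=1}^r\mathcal{K}_j$. *)

(* Defs.v *)
From HB Require Import structures.
From mathcomp Require Export all_boot all_order all_algebra qpoly.

Set Implicit Arguments.
Unset Strict Implicit.
Unset Printing Implicit Defensive.

Import GRing.Theory.

Local Open Scope ring_scope.

(* Ideals are not required to be proper (MathComp's [idealr_closed] is). *)
Definition is_ideal (A : nzRingType) (I : {pred A}) : Prop :=
  0 \in I /\ (forall a : A, {in I &, forall x y, a * x + y \in I}).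

Section ChainRing.
Variable R : finComNzRingType.

Definition principal (c : R) : {set R} := [set a * c | a : R].

Definition is_chain_ring : Prop :=
  forall I J : {set R}, is_ideal I -> is_ideal J -> I \subset J \/ J \subset I.

Definition is_maximal_ideal (M : {set R}) : Prop :=
  [/\ is_ideal M, M != setT
    & forall J : {set R}, is_ideal J -> M \subset J -> J = M \/ J = setT].

(* [pi] exhibits the field [F] as the quotient of [R] by the ideal [M]. *)
Definition is_residue_map (F : fieldType) (pi : {rmorphism R -> F})
    (M : {set R}) : Prop :=
  (forall y : F, exists x : R, pi x = y)
  /\ (forall x : R, pi x = 0 <-> x \in M).

(* {0, 1, zeta, ..., zeta ^ (q - 2)} *)
Definition teichmuller (q : nat) (zeta : R) : {set R} :=
  0 |: [set zeta ^+ i | i : 'I_q.-1].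

Definition comaximal (f g : {poly R}) : Prop :=
  exists u v : {poly R}, u * f + v * g = 1.

Definition basic_irreducible (F : fieldType) (pi : {rmorphism R -> F})
    (f : {poly R}) : Prop :=
  irreducible_poly (map_poly pi f).

Definition cc_poly (N : nat) (lam : R) : {poly R} := 'X^N - lam%:P.

(* (a_0, ..., a_(N-1)) |-> (lam a_(N-1), a_0, ..., a_(N-2)); [ord_pred] is the
   predecessor modulo N. *)
Definition cc_shift (N : nat) (lam : R) (a : 'rV[R]_N) : 'rV[R]_N :=
  \row_(i < N) ((if i == 0%N :> nat then lam else 1) * a 0 (ord_pred i)).

Definition constacyclic (N : nat) (lam : R) (C : {set 'rV[R]_N}) : Prop :=
  submod_closed C /\ {in C, forall a, cc_shift lam a \in C}.

(* (a_0, ..., a_(N-1)) |-> the class of a_0 + a_1 x + ... + a_(N-1) x^(N-1) *)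
Definition word_qpoly (N : nat) (lam : R) (a : 'rV[R]_N) :
    {poly %/ cc_poly N lam} :=
  in_qpoly (cc_poly N lam) (rVpoly a).

Section DirectSum.
Variables (r : nat) (k : 'I_r -> {poly R}).

(* The canonical map from R[x]/<h> to the direct sum of the R[x]/<k_j>, on the
   representative of degree less than deg h; it is well defined on classes when
   every k_j divides h. *)
Definition crt (h : {poly R}) (a : {poly %/ h}) :
    {dffun forall j : 'I_r, {poly %/ k j}} :=
  [ffun j => in_qpoly (k j) (a : {poly R})].

Definition is_crt_iso (h : {poly R}) : Prop :=
  bijective (@crt h)
  /\ (forall j : 'I_r,
        zmod_morphism (fun a : {poly %/ h} => crt a j)
        /\ monoid_morphism (fun a : {poly %/ h} => crt a j)).

Definition dsum (I : forall j : 'I_r, {set {poly %/ k j}}) :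
    {set {dffun forall j : 'I_r, {poly %/ k j}}} :=
  [set t : {dffun forall j : 'I_r, {poly %/ k j}} | [forall j, t j \in I j]].

End DirectSum.
End ChainRing.

(* Main.v *)
Require Import Defs.
From mathcomp Require Import ring.
Set Implicit Arguments.
Unset Strict Implicit.
Unset Printing Implicit Defensive.
Import GRing.Theory.
Local Open Scope ring_scope.

Import Pdiv.CommonRing Pdiv.RingMonic.

(** Both parts rest on two identifications.

    First, a word is the coefficient vector of the reduced representative of a
    class modulo h = x^N - lam, so words and classes correspond bijectively and
    linearly.  Since x^N = lam modulo h, the constacyclic shift becomes
    multiplication by the class of x ([word_qpoly_shift]).  A submodule stable
    under x is stable under every polynomial in x, that is, an ideal
    ([constacyclic_ideal]).

    Secondly, h is a product of pairwise comaximal monic k_j, and the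
    Chinese remainder map [crt] is a ring morphism because each k_j divides h.
    It is injective because a polynomial divisible by all the k_j is divisible
    by their product ([comaximal_prod_dvd]).  As R is finite, and both sides
    have #|R| ^ deg h elements, it is bijective ([crt_bij]).

    An ideal of a finite product of rings is the product of its projections:
    if c_j in C has the prescribed j-th component and e_j is the idempotent that
    is 1 at j and 0 elsewhere, then the sum of the e_j c_j lies in C and has all
    the prescribed components ([ideal_crt_image]).  This is (a).  For (b), the
    preimage of a product of ideals under a ring morphism is an ideal, and
    bijectivity gives its cardinality.

    The irreducibility of the f_j enters through degrees: it makes each f_j
    nonconstant, hence each k_j too, so that every K_j is a nonzero ring. *)

(** * Reduction modulo a monic polynomial *)

(** The quotient ring {poly %/ h} is taken modulo [mk_monic h], which replaces h
    by 'X unless h is monic and nonconstant.  The equation [mk_monic h = h] is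
    therefore used below as the hypothesis that h is a genuine modulus. *)
Lemma mk_monic_id (R : nzRingType) (h : {poly R}) :
  (1 < size h)%N -> h \is monic -> mk_monic h = h.
Proof. by rewrite /mk_monic => -> ->. Qed.

Lemma in_qpolyK (R : nzRingType) (h : {poly R}) :
  cancel (@polyn R _) (in_qpoly h).
Proof. by move=> a; apply/val_inj/in_qpoly_small/size_mk_monic. Qed.

Lemma in_qpoly_mull (R : nzRingType) (h q : {poly R}) :
  mk_monic h = h -> in_qpoly h (q * h) = 0.
Proof.
move=> hE; have hM := monic_mk_monic h.
by apply: val_inj; rewrite /= hE rmodp_mull // -hE.
Qed.

Lemma in_qpoly_eq0 (R : nzRingType) (h p : {poly R}) :
  mk_monic h = h -> in_qpoly h p = 0 -> exists q, p = q * h.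
Proof.
move=> hE /(congr1 val) /= p0; have hM := monic_mk_monic h.
exists (rdivp p (mk_monic h)).
by rewrite -[X in _ * X]hE {1}(rdivp_eq hM p) p0 addr0.
Qed.

(** Reducing modulo h first is harmless when the final modulus k divides h; this
    is what makes the Chinese remainder map multiplicative. *)
Lemma in_qpoly_rmodp (R : comNzRingType) (h k q p : {poly R}) :
  mk_monic h = h -> mk_monic k = k -> h = q * k ->
  in_qpoly k (in_qpoly h p) = in_qpoly k p.
Proof.
move=> hE kE hqk; have hM := monic_mk_monic h.
rewrite [in RHS](rdivp_eq hM p) in_qpolyD [X in _ * X]hE hqk mulrA.
by rewrite in_qpoly_mull // add0r -hqk.
Qed.

(** * Comaximal polynomials *)

(** Multiplying two relations u d + v a = 1 and u' d + v' b = 1 leaves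
    (v v') (a b) and multiples of d. *)
Lemma comaximal_prod (R : finComNzRingType) (I : eqType) (s : seq I)
    (k : I -> {poly R}) (d : {poly R}) :
  {in s, forall i, comaximal d (k i)} -> comaximal d (\prod_(i <- s) k i).
Proof.
elim: s => [|i s IHs] dk.
  by exists 0, 1; rewrite big_nil mul0r add0r mulr1.
have [|u [v uv1]] := dk i; first by rewrite mem_head.
have [|u' [v' uv1']] := IHs.
  by move=> j js; apply: dk; rewrite inE js orbT.
rewrite big_cons.
exists (u * u' * d + u * v' * \prod_(j <- s) k j + v * k i * u'), (v * v').
transitivity ((u * d + v * k i) * (u' * d + v' * \prod_(j <- s) k j)).
  ring.
by rewrite uv1 uv1' mulr1.
Qed.

(** If p = a x = b y and u x + v y = 1, then p = u x p + v y p, and replacing p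
    by b y in the first term and by a x in the second makes x y a factor.  No
    cancellation is used, so zero divisors in R do not matter. *)
Lemma comaximal_prod_dvd (R : finComNzRingType) (I : eqType) (s : seq I)
    (k : I -> {poly R}) (p : {poly R}) :
    uniq s -> {in s &, forall i j, i != j -> comaximal (k i) (k j)} ->
    {in s, forall i, exists q, p = q * k i} ->
  exists q, p = q * \prod_(i <- s) k i.
Proof.
elim: s => [|i s IHs] /=; first by exists p; rewrite big_nil mulr1.
case/andP=> s'i Us kc kp; rewrite big_cons.
have [|u [v uv1]] := @comaximal_prod R I s k (k i).
  move=> j js; apply: kc; rewrite ?mem_head ?inE ?js ?orbT //.
  by apply: contraNneq s'i => ->.
have [a pa] := kp i (mem_head i s).
have [//|j l js ls|j js|b pb] := IHs.
- by apply: kc; rewrite inE ?js ?ls orbT.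
- by apply: kp; rewrite inE js orbT.
exists (u * b + v * a).
transitivity (u * k i * p + v * \prod_(j <- s) k j * p).
  by rewrite -mulrDl uv1 mul1r.
rewrite {1}pb pa; ring.
Qed.

(** * Constacyclic codes as ideals *)

Section ConstacyclicWords.
Context (R : finComNzRingType) (N : nat) (lam : R) (N_gt0 : (0 < N)%N).
Local Notation h := (cc_poly N lam).
Implicit Types (a b : 'rV[R]_N) (C : {set 'rV[R]_N}).

Lemma mk_monic_cc : mk_monic h = h.
Proof. by apply: mk_monic_id; rewrite ?size_XnsubC ?monicXnsubC. Qed.

Lemma word_qpolyE a : word_qpoly lam a = rVpoly a :> {poly R}.
Proof.
by apply: in_qpoly_small; rewrite mk_monic_cc size_XnsubC // ltnS size_poly.
Qed.

Lemma word_qpoly_bij : bijective (@word_qpoly R N lam).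
Proof.
exists (fun x : {poly %/ h} => poly_rV (x : {poly R})) => [a|x].
  by rewrite word_qpolyE rVpolyK.
rewrite /word_qpoly poly_rV_K ?in_qpolyK //.
rewrite -ltnS -(size_XnsubC lam N_gt0) -/(cc_poly N lam).
by rewrite -[X in (_ < size (polyseq X))%N]mk_monic_cc size_mk_monic.
Qed.

Lemma word_qpolyP (c : R) a b :
  word_qpoly lam (c *: a + b)
  = in_qpoly h c%:P * word_qpoly lam a + word_qpoly lam b.
Proof. by rewrite /word_qpoly linearP /= in_qpolyD -mul_polyC in_qpolyM. Qed.

Lemma word_qpoly0 : word_qpoly lam (0 : 'rV[R]_N) = 0.
Proof. by rewrite /word_qpoly !linear0. Qed.

(** Multiplying by x moves every coefficient up by one and produces the term
    a_(N-1) x^N; subtracting a_(N-1) h trades it for lam a_(N-1) in degree 0. *)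
Lemma word_qpoly_shift a :
  word_qpoly lam (cc_shift lam a) = in_qpoly h 'X * word_qpoly lam a.
Proof.
rewrite -in_qpolyM.
pose i0 : 'I_N := Ordinal N_gt0.
have -> : 'X * rVpoly a = a 0 (ord_pred i0) *: h + rVpoly (cc_shift lam a).
  have i0E : ord_pred i0 = N.-1 :> nat by rewrite /= add0n modn_small ?prednK.
  apply/polyP=> j; rewrite coefXM coefD coefZ coefB coefXn coefC.
  case: (ltngtP j N) => [jN|jN|->].
  - have ->: j = Ordinal jN by [].
    rewrite coef_rVpoly_ord mxE /=; case: j jN => [|j] jN /=.
      rewrite (_ : Ordinal jN = i0); last exact: val_inj.
      by rewrite sub0r mulrN mulrC addNr.
    rewrite subrr mulr0 add0r mul1r -(coef_rVpoly_ord a) /=.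
    by rewrite modnDr modn_small // ltnW.
  - rewrite !nth_default ?gtn_eqF ?(leq_trans N_gt0) //= ?(ltnW jN) //;
      rewrite ?subrr ?mulr0 ?addr0 //.
    + by rewrite (leq_trans _ (ltnW jN)) ?size_poly.
    + by rewrite (leq_trans (size_poly _ _)) // -ltnS (ltn_predK jN).
  - rewrite gtn_eqF // subr0 mulr1 [X in _ + X]nth_default ?size_poly // addr0.
    by rewrite -i0E coef_rVpoly_ord.
by rewrite in_qpolyD -mul_polyC in_qpoly_mull ?mk_monic_cc // add0r.
Qed.

(** Stability under scalars and under x gives stability under all polynomials by
    Horner's scheme, and every class modulo h is the class of a polynomial. *)
Lemma constacyclic_ideal C :
  constacyclic lam C <-> is_ideal (word_qpoly lam @: C).
Proof.
have word_inj := bij_inj word_qpoly_bij.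
split=> [[[C0 CP] Cs]|[C0 CP]].
  have CX (q : {poly R}) b : b \in C ->
      in_qpoly h q * word_qpoly lam b \in word_qpoly lam @: C.
    move=> bC; elim/poly_ind: q => [|q c /imsetP[d dC qE]].
      by rewrite in_qpoly0 mul0r -word_qpoly0 imset_f.
    rewrite in_qpolyD in_qpolyM mulrDl mulrAC qE mulrC -word_qpoly_shift addrC.
    by rewrite -word_qpolyP imset_f // CP // Cs.
  split=> [|x _ _ /imsetP[a aC ->] /imsetP[b bC ->]].
    by rewrite -word_qpoly0 imset_f.
  have /imsetP[d dC] := CX x a aC; rewrite in_qpolyK => ->.
  rewrite (_ : _ + _ = word_qpoly lam (1 *: d + b)) ?imset_f ?CP //.
  by rewrite word_qpolyP polyC1 in_qpoly1 mul1r.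
have memC a : (word_qpoly lam a \in word_qpoly lam @: C) = (a \in C).
  exact: mem_imset.
split=> [|a aC].
  split=> [|c a b aC bC]; first by rewrite -memC word_qpoly0.
  by rewrite -memC word_qpolyP CP ?memC.
rewrite -memC word_qpoly_shift -[X in X \in _]addr0.
by rewrite CP ?memC.
Qed.

End ConstacyclicWords.

(** * The Chinese remainder decomposition *)

Lemma size_prod_monic (R : nzRingType) (I : Type) (s : seq I)
    (k : I -> {poly R}) :
    (forall i, k i \is monic) ->
  (size (\prod_(i <- s) k i)).-1 = (\sum_(i <- s) (size (k i)).-1)%N.
Proof.
move=> kM; elim: s => [|i s IHs]; first by rewrite !big_nil size_poly1.
have PM : \prod_(j <- s) k j \is monic by apply: monic_prod.
rewrite !big_cons -IHs size_monicM ?monic_neq0 //.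
by rewrite (polySpred (monic_neq0 (kM i))) (polySpred (monic_neq0 PM)) addnS.
Qed.

Lemma crtE (R : finComNzRingType) (r : nat) (k : 'I_r -> {poly R})
    (h : {poly R}) (a : {poly %/ h}) (j : 'I_r) :
  crt k a j = in_qpoly (k j) a.
Proof. exact: ffunE. Qed.

Section ChineseRemainder.
Context (R : finComNzRingType) (r : nat) (k : 'I_r -> {poly R}) (h : {poly R}).
Hypothesis k_monic : forall j, mk_monic (k j) = k j.
Hypothesis h_monic : mk_monic h = h.
Hypothesis k_coprime : forall i j, i != j -> comaximal (k i) (k j).
Hypothesis h_prod : h = \prod_(j < r) k j.

Lemma factor_of_prod j : exists q, h = q * k j.
Proof.
by exists (\prod_(i < r | i != j) k i); rewrite mulrC h_prod (bigD1 j).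
Qed.

Lemma crt_in_qpoly (p : {poly R}) j : crt k (in_qpoly h p) j = in_qpoly (k j) p.
Proof.
by have [q hq] := factor_of_prod j; rewrite crtE (in_qpoly_rmodp _ _ _ hq).
Qed.

Lemma crtD (a b : {poly %/ h}) j : crt k (a + b) j = crt k a j + crt k b j.
Proof. by rewrite !crtE -in_qpolyD. Qed.

Lemma crtB (a b : {poly %/ h}) j : crt k (a - b) j = crt k a j - crt k b j.
Proof. by apply: (addIr (crt k b j)); rewrite -crtD !subrK. Qed.

Lemma crtM (a b : {poly %/ h}) j : crt k (a * b) j = crt k a j * crt k b j.
Proof. by rewrite -[a * b]/(in_qpoly h _) crt_in_qpoly in_qpolyM !crtE. Qed.

Lemma crt1 j : crt k (1 : {poly %/ h}) j = 1.
Proof. by rewrite crtE in_qpoly1. Qed.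

Lemma crt0 j : crt k (0 : {poly %/ h}) j = 0.
Proof. by rewrite crtE in_qpoly0. Qed.

Lemma crt_sum (I : Type) (s : seq I) (F : I -> {poly %/ h}) j :
  crt k (\sum_(i <- s) F i) j = \sum_(i <- s) crt k (F i) j.
Proof.
by apply: (big_morph (fun a => crt k a j)) => [a b|]; rewrite ?crtD ?crt0.
Qed.

Lemma crt_inj : injective (@crt R r k h).
Proof.
move=> a b /ffunP ab.
have [||j _|q] :=
  @comaximal_prod_dvd R _ (index_enum 'I_r) k (a - b : {poly %/ h}).
- exact: index_enum_uniq.
- by move=> i j _ _; apply: k_coprime.
- apply: in_qpoly_eq0 => //.
  by rewrite -crtE crtB (ab j) subrr.
rewrite -h_prod => abq; apply/eqP; rewrite -subr_eq0; apply/eqP.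
by rewrite -[LHS]in_qpolyK abq in_qpoly_mull.
Qed.

(** Injectivity suffices, the two finite sets having the same cardinal because
    the degree of a product of monic polynomials is the sum of the degrees. *)
Lemma crt_bij : bijective (@crt R r k h).
Proof.
apply: inj_card_bij crt_inj _.
rewrite card_dep_ffun foldrE big_map big_enum card_qpoly h_monic h_prod.
rewrite size_prod_monic => [|j]; last by rewrite -k_monic monic_mk_monic.
rewrite expn_sum; apply: eq_leq; apply: eq_bigr => j _.
by rewrite card_qpoly k_monic.
Qed.

Lemma crt_iso : is_crt_iso k h.
Proof.
split=> [|j]; first exact: crt_bij.
by split=> [a b|]; [apply: crtB | split=> [|a b]; [apply: crt1 | apply: crtM]].
Qed.

Lemma crt_idempotent j :
  exists e : {poly %/ h}, forall i, crt k e i = (i == j)%:R.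
Proof.
have [g _ gK] := crt_bij.
by exists (g [ffun i => (i == j)%:R]) => i; rewrite gK ffunE.
Qed.

(** The components J j are the projections of I.  Only the inclusion of the
    direct sum in the image has content: elements of I realizing each component
    separately are glued with the idempotents. *)
Lemma ideal_crt_image (I : {set {poly %/ h}}) : is_ideal I ->
  exists2 J : forall j, {set {poly %/ k j}}, forall j, is_ideal (J j)
  & @crt R r k h @: I = dsum J.
Proof.
case=> I0 IP; exists (fun j => [set crt k a j | a in I]) => [j|].
  split=> [|x _ _ /imsetP[a aI ->] /imsetP[b bI ->]].
    by rewrite -(crt0 j) imset_f.
  rewrite -[x]in_qpolyK -crt_in_qpoly -crtM -crtD imset_f //; exact: IP.
apply/setP=> t; rewrite inE; apply/imsetP/forallP => [[a aI ->] j|tI].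
  exact: imset_f.
have ID (a b : {poly %/ h}) : a \in I -> b \in I -> a + b \in I.
  by move=> aI bI; rewrite -[a]mul1r IP.
have IM (a b : {poly %/ h}) : b \in I -> a * b \in I.
  by move=> bI; rewrite -[_ * _]addr0 IP.
have cP j : exists a : {poly %/ h}, (a \in I) && (crt k a j == t j).
  by have /imsetP[a aI ->] := tI j; exists a; rewrite aI eqxx.
have eP j : exists e : {poly %/ h}, [forall i, crt k e i == (i == j)%:R].
  by have [e eE] := crt_idempotent j; exists e; apply/forallP => i; rewrite eE.
pose c j := xchoose (cP j); pose e j := xchoose (eP j).
exists (\sum_j e j * c j).
  elim/big_ind: _ => // j _; apply: IM.
  by have /andP[] := xchooseP (cP j).
(* At component i only the i-th summand survives. *)
apply/ffunP=> i; rewrite crt_sum (bigD1 i) //= big1 => [|j ji].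
  rewrite addr0 crtM (eqP (forallP (xchooseP (eP i)) i)) eqxx mul1r.
  by have /andP[_ /eqP] := xchooseP (cP i).
rewrite crtM (eqP (forallP (xchooseP (eP j)) i)) eq_sym (negPf ji).
exact: mul0r.
Qed.

Lemma dsum_crt_preim (J : forall j, {set {poly %/ k j}}) :
  (forall j, is_ideal (J j)) -> is_ideal (@crt R r k h @^-1: dsum J).
Proof.
move=> JI; split=> [|x a b]; rewrite !inE.
  by apply/forallP=> j; rewrite crt0; have [] := JI j.
move=> /forallP aJ /forallP bJ; apply/forallP=> j.
rewrite crtD crtM; have [_ JP] := JI j.
by apply: JP; [apply: aJ | apply: bJ].
Qed.

Lemma card_dsum_crt_preim (J : forall j, {set {poly %/ k j}}) :
  #|@crt R r k h @^-1: dsum J| = (\prod_(j < r) #|J j|)%N.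
Proof.
rewrite on_card_preimset; last exact/onW_bij/crt_bij.
rewrite -cardsXn; apply: eq_card => t.
by rewrite !inE.
Qed.

End ChineseRemainder.

(** * Constacyclic codes of length n p^s *)

Theorem proposition3p1
  (R : finComNzRingType) (gamma : R)
  (chainR : is_chain_ring R)
  (maxgamma : is_maximal_ideal (principal gamma))
  (gamma_neq0 : gamma != 0) (gamma_sqr : gamma ^+ 2 = 0)
  (F : finFieldType) (pi : {rmorphism R -> F})
  (residue : is_residue_map pi (principal gamma))
  (p m : nat) (p_prime : prime p) (cardF : #|F| = (p ^ m)%N)
  (zeta : R) (zeta_order : (p ^ m - 1).-primitive_root zeta)
  (n s : nat) (n_gt0 : (0 < n)%N) (s_gt0 : (0 < s)%N)
  (coprime_n_p : coprime n p)
  (alpha beta alpha0 : R)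
  (alphaT : alpha \in teichmuller (p ^ m) zeta) (alpha_neq0 : alpha != 0)
  (betaT : beta \in teichmuller (p ^ m) zeta)
  (alpha0T : alpha0 \in teichmuller (p ^ m) zeta)
  (alpha0E : alpha0 ^+ (p ^ s) = alpha)
  (r : nat) (f g k : 'I_r -> {poly R})
  (f_prod : 'X^n - alpha0%:P = \prod_(j < r) f j)
  (f_monic : forall j, f j \is monic)
  (f_coprime : forall i j, i != j -> comaximal (f i) (f j))
  (f_irr : forall j, basic_irreducible pi (f j))
  (k_prod : 'X^(n * p ^ s) - (alpha + gamma * beta)%:P = \prod_(j < r) k j)
  (kE : forall j, k j = f j ^+ (p ^ s) + gamma *: g j)
  (k_monic : forall j, k j \is monic)
  (k_coprime : forall i j, i != j -> comaximal (k i) (k j))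
  (k_degree : forall j, (size (k j)).-1 = ((size (f j)).-1 * p ^ s)%N) :
  let N := (n * p ^ s)%N in
  let lam := alpha + gamma * beta in
  let h := cc_poly N lam in
  [/\ bijective (@word_qpoly R N lam),
      is_crt_iso k h,
      forall C : {set 'rV[R]_N},
        (constacyclic lam C <-> is_ideal (word_qpoly lam @: C))
        /\ (constacyclic lam C ->
            exists2 Cj : forall j : 'I_r, {set {poly %/ k j}},
              forall j, is_ideal (Cj j)
              & @crt R r k h @: (word_qpoly lam @: C) = dsum Cj)
    & forall Ij : forall j : 'I_r, {set {poly %/ k j}},
        (forall j, is_ideal (Ij j)) ->
        let I : {set {poly %/ h}} := @crt R r k h @^-1: dsum Ij in
        [/\ is_ideal I,
            constacyclic lam (@word_qpoly R N lam @^-1: I)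
          & #|I| = (\prod_(j < r) #|Ij j|)%N]].
Proof.
move=> N lam h.
have N_gt0 : (0 < N)%N by rewrite muln_gt0 n_gt0 expn_gt0 prime_gt0.
have hE : mk_monic h = h by apply: mk_monic_cc.
have kE' j : mk_monic (k j) = k j.
  apply: mk_monic_id => //; rewrite -ltn_predRL k_degree muln_gt0.
  rewrite expn_gt0 (prime_gt0 p_prime) andbT ltn_predRL.
  (* f j is monic, so it has the same size as its irreducible reduction. *)
  have [+ _] := f_irr j; rewrite size_map_poly_id0 //.
  by rewrite (eqP (f_monic j)) rmorph1 oner_eq0.
have word_bij := @word_qpoly_bij R N lam N_gt0.
split=> //.
- exact: crt_iso.
- move=> C; split; first exact: constacyclic_ideal.
  by move/(constacyclic_ideal _ N_gt0); apply: ideal_crt_image.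
move=> J JI I; have II : is_ideal I by apply: dsum_crt_preim.
split=> //; last exact: card_dsum_crt_preim.
apply/constacyclic_ideal => //.
have [u uK Ku] := word_bij.
rewrite (can2_imset_pre _ uK Ku) (_ : _ @^-1: _ = I) //.
by apply/setP=> x; rewrite !inE Ku.
Qed.
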